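(* Let $\ell>0$. For all $\mu_0,\mu_1\in\mathcal M(X)$ and all $r_0,r_1\ge 0$, $$\mathsf{HK}_\ell^2(r_0^2\mu_0,r_1^2\mu_1)=r_0r_1\,\mathsf{HK}_\ell^2(\mu_0,\mu_1)+(r_0^2-r_0r_1)\,\mu_0(X)+(r_1^2-r_0r_1)\,\mu_1(X).$$ Moreover, if $H_{01}$ is an optimal plan for the logarithmic-entropy-transport formulation of $\mathsf{HK}_\ell(\mu_0,\mu_1)$, then $r_0r_1H_{01}$ is an optimal plan for $\mathsf{HK}_\ell(r_0^2\mu_0,r_1^2\mu_1)$.
   Context: $(X,\mathsf d_X)$ is a geodesic, Polish metric space and $\mathcal M(X)$ is the set of all nonnegative finite Borel measures on $X$. Let $F(r)=r\log r-r+1$ for $r\ge0$ (with $F(0)=1$) and $L_\ell(R)=-2\log(\cos(\ell R))$ if $\ell R<\pi/2$, $L_\ell(R)=+\infty$ otherwise. For $\mu_0,\mu_1\in\mathcal M(X)$ and $H_{01}\in\mathcal M(X\times X)$ whose marginals $\eta_i=(\pi^i)_\sharp H_{01}$ satisfy $\eta_i=\sigma_i\mu_i\ll\mu_i$ ($i=0,1$), set $$\mathcal{LET}_\ell(H_{01};\mu_0,\mu_1)=\int_XF(\sigma_0)\,d\mu_0+\int_XF(\sigma_1)\,d\mu_1+\iint_{X\times X}L_\ell(\mathsf d_X(x_0,x_1))\,dH_{01}.$$ The Hellinger–Kantorovich distance is defined by $\mathsf{HK}_\ell^2(\mu_0,\mu_1)=\min\{\mathcal{LET}_\ell(H_{01};\mu_0,\mu_1):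 H_{01}\in\mathcal M(X\times X),\ (\pi^i)_\sharp H_{01}\ll\mu_i,\ i=0,1\}$ (the minimum is attained); a minimizer is called an optimal plan for $\mathsf{HK}_\ell(\mu_0,\mu_1)$. *)

(* Defs.v *)
From HB Require Import structures.
From mathcomp Require Import all_boot all_order all_algebra.
From mathcomp Require Import all_classical all_reals all_analysis.

Set Implicit Arguments.
Unset Strict Implicit.
Unset Printing Implicit Defensive.

Import Order.TTheory GRing.Theory Num.Theory.
Import numFieldNormedType.Exports.

Local Open Scope classical_set_scope.
Local Open Scope ring_scope.

(* [Complete] includes a distinguished point, as [measurableType] also does:
   the spaces considered here are nonempty. *)
#[short(type="completeMetricType")]
HB.structure Definition CompleteMetric (R : numDomainType) :=
  {T of Metric R T & Complete T}.

Definition separable_space (T : topologicalType) : Prop :=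
  exists2 D : set T, countable D & dense D.

Definition geodesic_space (R : realType) (X : metricType R) : Prop :=
  forall x y : X, exists gamma : R -> X,
    [/\ gamma 0 = x, gamma 1 = y &
      forall s t, 0 <= s <= 1 -> 0 <= t <= 1 ->
        mdist (gamma s) (gamma t) = `|s - t| * mdist x y].

(* A notation, so that the instances of [g_sigma_algebraType] are found. *)
Notation borel T := (g_sigma_algebraType (open : set (set T))).

Section marginals.
Context (R : realType) (X : completeMetricType R).

Let pr0 : borel (X * X)%type -> borel X := fst.
Let pr1 : borel (X * X)%type -> borel X := snd.

Let measurable_pr0 : measurable_fun setT pr0.
Proof.
apply: (@measurability _ _ (borel (X * X)%type) (borel X) _ pr0 open).
  by [].
move=> _ [A oA <-]; rewrite setTI; apply: sub_gen_smallest.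
have /continuousP : continuous (@fst X X) by move=> x; exact: cvg_fst.
exact.
Qed.

Let measurable_pr1 : measurable_fun setT pr1.
Proof.
apply: (@measurability _ _ (borel (X * X)%type) (borel X) _ pr1 open).
  by [].
move=> _ [A oA <-]; rewrite setTI; apply: sub_gen_smallest.
have /continuousP : continuous (@snd X X) by move=> x; exact: cvg_snd.
exact.
Qed.

HB.instance Definition _ :=
  isMeasurableFun.Build _ _ _ _ pr0 measurable_pr0.
HB.instance Definition _ :=
  isMeasurableFun.Build _ _ _ _ pr1 measurable_pr1.

Variable H : {finite_measure set (borel (X * X)%type) -> \bar R}.

Definition marginal0 : set (borel X) -> \bar R := pushforward H pr0.
Definition marginal1 : set (borel X) -> \bar R := pushforward H pr1.

Let marginal0_0 : marginal0 set0 = 0%E.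
Proof. exact: measure0. Qed.

Let marginal0_ge0 A : (0 <= marginal0 A)%E.
Proof. exact: measure_ge0. Qed.

Let marginal0_sigma_additive : semi_sigma_additive marginal0.
Proof. exact: measure_semi_sigma_additive. Qed.

HB.instance Definition _ := isMeasure.Build _ _ _ marginal0
  marginal0_0 marginal0_ge0 marginal0_sigma_additive.

Let marginal0_fin : fin_num_fun marginal0.
Proof.
move=> A mA; apply: fin_num_measure.
by rewrite -[X in measurable X]setTI; exact: measurable_pr0.
Qed.

HB.instance Definition _ :=
  Measure_isFinite.Build _ _ _ marginal0 marginal0_fin.

Let marginal1_0 : marginal1 set0 = 0%E.
Proof. exact: measure0. Qed.

Let marginal1_ge0 A : (0 <= marginal1 A)%E.
Proof. exact: measure_ge0. Qed.

Let marginal1_sigma_additive : semi_sigma_additive marginal1.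
Proof. exact: measure_semi_sigma_additive. Qed.

HB.instance Definition _ := isMeasure.Build _ _ _ marginal1
  marginal1_0 marginal1_ge0 marginal1_sigma_additive.

Let marginal1_fin : fin_num_fun marginal1.
Proof.
move=> A mA; apply: fin_num_measure.
by rewrite -[X in measurable X]setTI; exact: measurable_pr1.
Qed.

HB.instance Definition _ :=
  Measure_isFinite.Build _ _ _ marginal1 marginal1_fin.

End marginals.

Section logarithmic_entropy_transport.
Context (R : realType) (X : completeMetricType R).
Implicit Types mu : {finite_measure set (borel X) -> \bar R}.
Implicit Types H : {finite_measure set (borel (X * X)%type) -> \bar R}.
Local Open Scope ereal_scope.

(* At r = 0 this is F(0) = 1, as [0 * ln 0 = 0]. *)
Definition entropy_fun (r : R) : R := (r * ln r - r + 1)%R.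

Definition transport_cost (ell r : R) : \bar R :=
  if (ell * r < pi / 2)%R then (- 2 * ln (cos (ell * r)))%R%:E else +oo.

(* This version of the Radon-Nikodym derivative is nonnegative and finite at
   every point when [nu `<< mu]; it is a junk value otherwise. *)
Definition density (nu mu : {finite_measure set (borel X) -> \bar R}) (x : X) : R :=
  fine (Radon_Nikodym_SigmaFinite.f nu mu x).

Definition admissible_plan mu0 mu1 H : Prop :=
  marginal0 H `<< mu0 /\ marginal1 H `<< mu1.

Definition LET (ell : R) H mu0 mu1 : \bar R :=
  \int[mu0]_x (entropy_fun (density (marginal0 H) mu0 x))%:E +
  \int[mu1]_x (entropy_fun (density (marginal1 H) mu1 x))%:E +
  \int[H]_z transport_cost ell (mdist z.1 z.2).

(* The square of the Hellinger-Kantorovich distance. The infimum is attained,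
   so that this is the minimum. *)
Definition HK2 (ell : R) mu0 mu1 : \bar R :=
  ereal_inf [set LET ell H mu0 mu1 | H in admissible_plan mu0 mu1].

Definition optimal_plan (ell : R) mu0 mu1 H : Prop :=
  admissible_plan mu0 mu1 H /\
  forall H', admissible_plan mu0 mu1 H' ->
    LET ell H mu0 mu1 <= LET ell H' mu0 mu1.

End logarithmic_entropy_transport.

(* Main.v *)
Require Import Defs.
From HB Require Import structures.
From mathcomp Require Import all_boot all_order all_algebra.
From mathcomp Require Import all_classical all_reals all_analysis.
From mathcomp Require Import measurable_realfun ring lra.
Import Order.TTheory GRing.Theory Num.Theory.
Import numFieldNormedType.Exports.
Local Open Scope classical_set_scope.
Local Open Scope ring_scope.
Local Open Scope ereal_scope.

(* With s = r0 r1 > 0, the map H |-> s H is a bijection between the admissible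
   plans of (mu0, mu1) and of (r0^2 mu0, r1^2 mu1); it multiplies the densities
   by r1 / r0 and r0 / r1 respectively. Expanding F, the first entropy becomes
   s * entropy + s ln (r1 / r0) H(X x X) + (r0^2 - s) mu0(X); the second is
   symmetric, so the logarithmic terms cancel and LET is changed by the affine
   map of the theorem. If s = 0, one of the rescaled measures vanishes, so the
   only admissible plan is the null one. *)

(** * Sign, measurability and scaling of the entropy and cost integrands *)

Section entropy_fun.
Context {R : realType}.
Implicit Types r : R.

(** For [r > 0] this is [ln y <= y - 1] at [y = r^-1], multiplied by [r]. *)
Lemma entropy_fun_ge0 r : (0 <= r -> 0 <= entropy_fun r)%R.
Proof.
rewrite le_eqVlt => /predU1P[<-|r0]; first by rewrite /entropy_fun mul0r subr0 add0r.
have V0 : (0 < r^-1)%R by rewrite invr_gt0.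
have : (ln (1 + (r^-1 - 1)) <= r^-1 - 1)%R by apply: le_ln1Dx; lra.
rewrite addrC subrK lnV ?posrE// -(ler_pM2l r0) mulrBr divff ?gt_eqF//.
by rewrite /entropy_fun; lra.
Qed.

Lemma measurable_entropy_fun : measurable_fun setT (@entropy_fun R).
Proof.
apply: measurable_funD => //; apply: measurable_funB => //.
by apply: measurable_funM => //; exact: measurable_ln.
Qed.

(** Pointwise effect of multiplying a plan by [s] and its reference measure by [k]: the density [r]
    becomes [s / k * r], and splitting [ln (s / k * r)] creates the term linear in [r]. *)
Lemma entropy_fun_scale (s k r : R) : (0 < s -> 0 < k -> 0 <= r ->
  k * entropy_fun (s / k * r) =
  s * entropy_fun r + s * ln (s / k) * r + (k - s))%R.
Proof.
move=> s0 k0; rewrite /entropy_fun le_eqVlt => /predU1P[<-|r0].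
  by rewrite !(mulr0, mul0r); ring.
rewrite lnM ?posrE ?divr_gt0//; field.
by rewrite gt_eqF.
Qed.

Lemma transport_cost_ge0 (ell r : R) : 0 <= transport_cost ell r.
Proof.
rewrite /transport_cost; case: ifP => // _; rewrite lee_fin.
(* [ell * r] is not bounded below here, so the cosine may be nonpositive; [ln] is then [0] by
   default, and [cos <= 1] suffices for the sign. *)
by rewrite -mulrNN opprK mulr_ge0// oppr_ge0 ln_le0// cos_le1.
Qed.

Lemma measurable_transport_cost (ell : R) :
  measurable_fun setT (transport_cost ell).
Proof.
have ml : measurable_fun setT (fun r : R => (ell * r)%R).
  exact: measurable_funM.
apply: measurable_fun_ifT => //.
  exact: measurable_fun_ltr.
apply/measurable_EFinP/measurable_funM => //.
apply: measurableT_comp; first exact: measurable_ln.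
apply: measurableT_comp => //.
apply: continuous_measurable_fun; exact: continuous_cos.
Qed.

End entropy_fun.

(** * Borel measurability of the distance, and integrals against a multiple of a measure *)

Lemma continuous_mdist {R : realType} (X : metricType R) :
  continuous (fun z : X * X => mdist z.1 z.2).
Proof.
move=> [x y]; apply/cvgrPdist_lt => e e0 /=.
have e20 : (0 < e / 2)%R by rewrite divr_gt0.
exists (ball x (e / 2), ball y (e / 2)) => /=.
  by split; exact: nbhsx_ballx.
move=> [a b] /= []; rewrite !ballEmdist /= => xa yb.
(* Two triangle inequalities in each direction bound the change of the distance by
   [mdist x a + mdist y b]. *)
have := metric_triangle x a y; have := metric_triangle a b y.
have := metric_triangle a x b; have := metric_triangle x y b.
rewrite (metric_sym a x) (metric_sym b y) => ? ? ? ?.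
by rewrite ltr_norml; apply/andP; split; lra.
Qed.

Lemma measurable_mdist {R : realType} (X : completeMetricType R) :
  measurable_fun setT (fun z : borel (X * X)%type => mdist z.1 z.2 : R).
Proof.
apply: (measurability _ (RGenOpens.measurableE R)) => //.
move=> _ [_ [a [b ->]] <-]; rewrite setTI; apply: sub_gen_smallest.
by move/continuousP: (@continuous_mdist R X); apply; exact: interval_open.
Qed.

(** The scaling is assumed on measurable sets rather than as an equality with [mscale], so that it
    also covers arbitrary competitors of the rescaled problem. *)
Lemma ge0_integral_scaled {d} {T : measurableType d} {R : realType}
    {m m' : {measure set T -> \bar R}} {k : R} {D} {f : T -> \bar R} :
  (0 <= k)%R -> (forall A, measurable A -> m' A = k%:E * m A) ->
  measurable D -> measurable_fun D f -> (forall x, D x -> 0 <= f x) ->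
  \int[m']_(x in D) f x = k%:E * \int[m]_(x in D) f x.
Proof.
move=> k0 m'E mD mf f0; rewrite -(ge0_integral_mscale m mD (NngNum k0))//.
by apply: eq_measure_integral => A mA _; exact: m'E.
Qed.

(** * Densities and the scaling of the entropy integral *)

Section density.
Context {R : realType} {X : completeMetricType R}.
Implicit Types mu nu : {finite_measure set (borel X) -> \bar R}.

Lemma density_ge0 nu mu x : nu `<< mu -> (0 <= density nu mu x)%R.
Proof. by move=> numu; exact/fine_ge0/Radon_Nikodym_SigmaFinite.f_ge0. Qed.

Lemma EFin_density nu mu : nu `<< mu ->
  EFin \o density nu mu = Radon_Nikodym_SigmaFinite.f nu mu.
Proof.
move=> numu; apply/funext => x /=; rewrite fineK//.
exact: Radon_Nikodym_SigmaFinite.f_fin_num.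
Qed.

Lemma integrable_density nu mu : nu `<< mu ->
  mu.-integrable setT (EFin \o density nu mu).
Proof.
by move=> numu; rewrite EFin_density//; exact: Radon_Nikodym_SigmaFinite.f_integrable.
Qed.

Lemma measurable_density nu mu : nu `<< mu ->
  measurable_fun setT (density nu mu : borel X -> R).
Proof. by move=> /integrable_density/measurable_int/measurable_EFinP. Qed.

Lemma integral_density nu mu A : nu `<< mu -> measurable A ->
  \int[mu]_(x in A) (density nu mu x)%:E = nu A.
Proof.
move=> numu mA; rewrite (Radon_Nikodym_SigmaFinite.f_integral numu)//.
by rewrite -EFin_density.
Qed.

(** Functions with equal integrals over all measurable sets agree [mu]-almost everywhere, so the
    chosen version of the density can be replaced by an explicit one. *)
Lemma integral_entropy_density nu mu (g : borel X -> R) :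
  nu `<< mu -> measurable_fun setT g ->
  (forall A, measurable A -> nu A = \int[mu]_(x in A) (g x)%:E) ->
  \int[mu]_x (entropy_fun (density nu mu x))%:E =
  \int[mu]_x (entropy_fun (g x))%:E.
Proof.
move=> numu mg nuE.
have fg : ae_eq mu setT (EFin \o density nu mu) (EFin \o g).
  apply: integral_ae_eq => //.
  - exact: integrable_density.
  - exact/measurable_EFinP.
  - by move=> A _ mA; rewrite integral_density// nuE.
apply: ae_eq_integral => //.
- apply/measurable_EFinP/measurableT_comp; first exact: measurable_entropy_fun.
  exact: measurable_density.
- by apply/measurable_EFinP/measurableT_comp; first exact: measurable_entropy_fun.
- by apply: filterS fg => x /(_ I) /= [->] _.
Qed.

(** Integrated form of [entropy_fun_scale]: [s / k] times the density of [nu] is a density of [nu'],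
    and the linear term integrates to a multiple of the mass of [nu]. *)
Lemma integral_entropy_density_scaled {nu nu' mu mu'} {s k : R} :
  (0 < s)%R -> (0 < k)%R -> nu `<< mu -> nu' `<< mu' ->
  (forall A, measurable A -> nu' A = s%:E * nu A) ->
  (forall A, measurable A -> mu' A = k%:E * mu A) ->
  \int[mu']_x (entropy_fun (density nu' mu' x))%:E =
  s%:E * \int[mu]_x (entropy_fun (density nu mu x))%:E +
  ((s * ln (s / k))%:E * nu setT +
   (k - s)%:E * mu setT).
Proof.
move=> s0 k0 numu numu' nuE muE.
pose f : borel X -> R := density nu mu; pose c := (s / k)%R.
have c0 : (0 < c)%R by rewrite divr_gt0.
have mf : measurable_fun setT f by exact: measurable_density.
have f0 x : (0 <= f x)%R by exact: density_ge0.
have mF g : measurable_fun setT g ->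
    measurable_fun setT (fun x : borel X => (entropy_fun (g x))%:E : \bar R).
  move=> mg; apply/measurable_EFinP/measurableT_comp => //.
  exact: measurable_entropy_fun.
have mcf : measurable_fun setT (fun x => c * f x)%R by exact: measurable_funM.
have cf0 x : (0 <= c * f x)%R by rewrite mulr_ge0// ltW.
rewrite (@integral_entropy_density _ _ (fun x => c * f x)%R)//; last first.
  move=> A mA; rewrite (ge0_integral_scaled (ltW k0) muE)//; last 2 first.
  - exact/measurable_EFinP/measurable_funTS.
  - by move=> x _; rewrite lee_fin.
  under eq_integral do rewrite EFinM.
  rewrite ge0_integralZl_EFin//; last 3 first.
  - by move=> x _; rewrite lee_fin.
  - exact/measurable_EFinP/measurable_funTS.
  - exact: ltW.
  rewrite integral_density// nuE// muleA -EFinM /c mulrCA divff ?mulr1//.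
  by rewrite gt_eqF.
rewrite (ge0_integral_scaled (ltW k0) muE)//; last 2 first.
- exact: mF.
- by move=> x _; rewrite lee_fin entropy_fun_ge0.
set I' := (X in _ * X = _); set I := (X in _ = _ * X + _).
have I0 : 0 <= I.
  by apply: integral_ge0 => x _; rewrite lee_fin entropy_fun_ge0.
have I'0 : 0 <= I'.
  by apply: integral_ge0 => x _; rewrite lee_fin entropy_fun_ge0.
(* [ln c] is split into its positive and negative parts, so that both sides of
   the pointwise identity are sums of nonnegative functions and [I], [I'] may
   be infinite. *)
pose p := Num.max (ln c) 0%R; pose q := Num.max (- ln c)%R 0%R.
have p0 : (0 <= p)%R by rewrite le_max lexx orbT.
have q0 : (0 <= q)%R by rewrite le_max lexx orbT.
have pq : ln c = (p - q)%R.
  by rewrite /p /q; case: (leP (ln c) 0%R) => ?; case: leP => ?; lra.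
(* Used for both sides of the identity below: with [g = c * f] and [a = k], then with [g = f] and
   [a = s]. *)
have intE (a b e : R) (g : borel X -> R) : (0 <= a)%R -> (0 <= b)%R -> (0 <= e)%R ->
    measurable_fun setT g -> (forall x, (0 <= g x)%R) ->
    \int[mu]_x (a * entropy_fun (g x) + (b * f x + e))%:E =
    a%:E * \int[mu]_x (entropy_fun (g x))%:E +
      (b%:E * nu setT + e%:E * mu setT).
  move=> a0 b0 e0 mg g0.
  have Fg0 x : (0 <= entropy_fun (g x))%R by exact: entropy_fun_ge0.
  have mbf : measurable_fun setT (fun x => (b * f x)%:E).
    by apply/measurable_EFinP; exact: measurable_funM.
  under eq_integral do rewrite (EFinD (a * _)) (EFinM a) (EFinD (b * _)).
  rewrite ge0_integralD//; last 4 first.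
  - by move=> x _; rewrite mule_ge0// lee_fin.
  - by apply: measurable_funeM; exact: mF.
  - by move=> x _; rewrite -EFinD lee_fin addr_ge0 ?mulr_ge0.
  - exact: emeasurable_funD.
  rewrite ge0_integralZl_EFin//; last 2 first.
  - by move=> x _; rewrite lee_fin.
  - exact: mF.
  rewrite ge0_integralD//; last first.
  - by move=> x _; rewrite lee_fin mulr_ge0.
  rewrite integral_cst//; congr (_ + (_ + _)).
  under eq_integral do rewrite EFinM.
  rewrite ge0_integralZl_EFin//; last 2 first.
  - by move=> x _; rewrite lee_fin.
  - exact/measurable_EFinP.
  by rewrite integral_density.
have : k%:E * I' + ((s * q)%:E * nu setT + s%:E * mu setT) =
       s%:E * I + ((s * p)%:E * nu setT + k%:E * mu setT).
  rewrite -!intE ?mulr_ge0 ?(ltW s0) ?(ltW k0)//; apply: eq_integral => x _; congr EFin.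
  by rewrite entropy_fun_scale// -/c pq; ring.
rewrite -/c pq.
rewrite -(fineK (fin_num_measure mu setT measurableT)).
rewrite -(fineK (fin_num_measure nu setT measurableT)) -!EFinM -!EFinD.
(* Both masses are finite, so the identity makes [I] and [I'] infinite together; otherwise it is
   linear in real numbers. *)
case: I I0 => [i _| _|//]; case: I' I'0 => [i' _| _|//]; rewrite ?gt0_muley ?lte_fin//=.
rewrite -!EFinM -!EFinD => -[ii']; congr EFin; lra.
Qed.

End density.

(** * Scaling of marginals and of absolute continuity *)

Section marginals.
Context {R : realType} {X : completeMetricType R}.
Implicit Types H : {finite_measure set (borel (X * X)%type) -> \bar R}.

(** Meant for the two projections: the scaling of a plan is known only on measurable sets, and a
    marginal evaluates the plan on a preimage. *)
Lemma measurable_preimage_continuous (f : X * X -> X) (A : set (borel X)) :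
  continuous f -> measurable A ->
  measurable (f @^-1` A : set (borel (X * X)%type)).
Proof.
move=> /continuousP cf.
have mf : measurable_fun setT (f : borel (X * X)%type -> borel X).
  apply: (@measurability _ _ (borel (X * X)%type) (borel X) _ f open) => //.
  by move=> _ [B oB <-]; rewrite setTI; apply: sub_gen_smallest; exact: cf.
by move=> mA; rewrite -[X in measurable X]setTI; exact: mf.
Qed.

Lemma marginal0_scaled {H H'} {s : R} {A} :
  (forall B, measurable B -> H' B = s%:E * H B) ->
  measurable A -> marginal0 H' A = s%:E * marginal0 H A.
Proof.
move=> H'E mA; apply: H'E; apply: measurable_preimage_continuous => //.
by move=> x; exact: cvg_fst.
Qed.

Lemma marginal1_scaled {H H'} {s : R} {A} :
  (forall B, measurable B -> H' B = s%:E * H B) ->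
  measurable A -> marginal1 H' A = s%:E * marginal1 H A.
Proof.
move=> H'E mA; apply: H'E; apply: measurable_preimage_continuous => //.
by move=> x; exact: cvg_snd.
Qed.

End marginals.

(** Since [k] is nonzero, a [mu']-null set is [mu]-null, hence [nu]-null. *)
Lemma null_dominates_scaled {d} {T : measurableType d} {R : realType}
    {nu nu' mu mu' : {measure set T -> \bar R}} {s k : R} :
  k != 0%R ->
  (forall A, measurable A -> nu' A = s%:E * nu A) ->
  (forall A, measurable A -> mu' A = k%:E * mu A) ->
  nu `<< mu -> nu' `<< mu'.
Proof.
move=> k0 nuE muE /null_content_dominatesP numu.
apply/null_content_dominatesP => A mA mu'A0.
have /eqP : k%:E * mu A = 0 by rewrite -muE.
rewrite mule_eq0 eqe (negPf k0) /= => /eqP muA0.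
transitivity (s%:E * nu A); first exact: nuE.
by rewrite [X in _ * X](numu A mA muA0) mule0.
Qed.

(** * Scaling of admissible plans, of their cost and of the infimum *)

Section scaling.
Context {R : realType} {X : completeMetricType R}.
Implicit Types mu nu : {finite_measure set (borel X) -> \bar R}.
Implicit Types H : {finite_measure set (borel (X * X)%type) -> \bar R}.

Lemma measurable_transport_cost_mdist (ell : R) :
  measurable_fun setT
    (fun z : borel (X * X)%type => transport_cost ell (mdist z.1 z.2)).
Proof.
apply: measurableT_comp; first exact: measurable_transport_cost.
exact: measurable_mdist.
Qed.

Lemma entropy_density_ge0 nu mu : nu `<< mu ->
  0 <= \int[mu]_x (entropy_fun (density nu mu x))%:E.
Proof.
move=> numu; apply: integral_ge0 => x _.
by rewrite lee_fin entropy_fun_ge0// density_ge0.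
Qed.

Lemma transport_integral_ge0 (ell : R) H :
  0 <= \int[H]_z transport_cost ell (mdist z.1 z.2).
Proof. by apply: integral_ge0 => x _; exact: transport_cost_ge0. Qed.

Lemma admissible_plan_scaled
    {mu0 mu1 mu0' mu1' : {finite_measure set (borel X) -> \bar R}} {H H'}
    {k0 k1 s : R} :
  k0 != 0%R -> k1 != 0%R ->
  (forall A, measurable A -> mu0' A = k0%:E * mu0 A) ->
  (forall A, measurable A -> mu1' A = k1%:E * mu1 A) ->
  (forall A, measurable A -> H' A = s%:E * H A) ->
  admissible_plan mu0 mu1 H -> admissible_plan mu0' mu1' H'.
Proof.
move=> k00 k10 mu0E mu1E HE [H0 H1]; split.
- apply: (null_dominates_scaled k00 _ mu0E H0) => A mA.
  exact: marginal0_scaled HE mA.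
- apply: (null_dominates_scaled k10 _ mu1E H1) => A mA.
  exact: marginal1_scaled HE mA.
Qed.

Lemma LET_scaled {ell : R}
    {mu0 mu1 mu0' mu1' : {finite_measure set (borel X) -> \bar R}} {H H'}
    {r0 r1 : R} :
  (0 < r0)%R -> (0 < r1)%R ->
  (forall A, measurable A -> mu0' A = (r0 ^+ 2)%:E * mu0 A) ->
  (forall A, measurable A -> mu1' A = (r1 ^+ 2)%:E * mu1 A) ->
  (forall A, measurable A -> H' A = (r0 * r1)%:E * H A) ->
  admissible_plan mu0 mu1 H ->
  LET ell H' mu0' mu1' = (r0 * r1)%:E * LET ell H mu0 mu1 +
    (r0 ^+ 2 - r0 * r1)%:E * mu0 setT + (r1 ^+ 2 - r0 * r1)%:E * mu1 setT.
Proof.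
move=> r00 r10 mu0E mu1E HE adm.
have s0 : (0 < r0 * r1)%R by exact: mulr_gt0.
have [k00 k10] : (0 < r0 ^+ 2)%R /\ (0 < r1 ^+ 2)%R by rewrite !exprn_gt0.
have [H'0 H'1] := admissible_plan_scaled
  (lt0r_neq0 k00) (lt0r_neq0 k10) mu0E mu1E HE adm.
case: adm => H0 H1; rewrite /LET.
(* The ascription replaces the total mass of the marginal by the convertible [H setT], so that both
   logarithmic terms carry the same mass. *)
have E0 : _ = _ + (_ * H setT + _) :=
  integral_entropy_density_scaled s0 k00 H0 H'0
    (fun A mA => marginal0_scaled HE mA) mu0E.
have E1 : _ = _ + (_ * H setT + _) :=
  integral_entropy_density_scaled s0 k10 H1 H'1
    (fun A mA => marginal1_scaled HE mA) mu1E.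
rewrite {}E0 {}E1.
rewrite (ge0_integral_scaled (ltW s0) HE)//; last 2 first.
- exact: measurable_transport_cost_mdist.
- by move=> z _; exact: transport_cost_ge0.
have I0 := entropy_density_ge0 _ _ H0; have I1 := entropy_density_ge0 _ _ H1.
have C0 := transport_integral_ge0 ell H.
(* The two density factors [r1 / r0] and [r0 / r1] are inverse to each other. *)
have lnV : ln (r0 * r1 / r1 ^+ 2) = (- ln (r0 * r1 / r0 ^+ 2))%R.
  rewrite -lnV ?posrE ?divr_gt0//; congr ln; field.
  by rewrite !gt_eqF.
rewrite lnV.
move: I0 I1 C0; move: (\int[mu0]_x _) (\int[mu1]_x _) (\int[H]_x _) => a b c.
rewrite -(fineK (fin_num_measure mu0 setT measurableT)).
rewrite -(fineK (fin_num_measure mu1 setT measurableT)).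
rewrite -(fineK (fin_num_measure H setT measurableT)).
(* If one of the three nonnegative integrals is infinite, both sides are [+oo]. *)
case: a => [a| |//] a0; case: b => [b| |//] b0; case: c => [c| |//] c0;
  rewrite -?EFinM -?EFinD ?(addye, addey)// ?gt0_muley ?lte_fin//.
by congr EFin; ring.
Qed.

(** Surjectivity of the rescaling of plans: the witness is [s^-1] times [H'], admissible by
    [admissible_plan_scaled] with the inverse factors. *)
Lemma admissible_plan_unscaled
    {mu0 mu1 mu0' mu1' : {finite_measure set (borel X) -> \bar R}} {H'}
    {k0 k1 s : R} :
  (0 < k0)%R -> (0 < k1)%R -> (0 < s)%R ->
  (forall A, measurable A -> mu0' A = k0%:E * mu0 A) ->
  (forall A, measurable A -> mu1' A = k1%:E * mu1 A) ->
  admissible_plan mu0' mu1' H' ->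
  exists2 H, admissible_plan mu0 mu1 H &
    forall A, measurable A -> H' A = s%:E * H A.
Proof.
move=> k00 k10 s0 mu0E mu1E adm.
have inv (k : R) (x : \bar R) : (0 < k)%R -> k^-1%:E * (k%:E * x) = x.
  by move=> ?; rewrite muleA -EFinM mulVf ?gt_eqF// mul1e.
have sV0 : (0 <= s^-1)%R by rewrite invr_ge0 ltW.
exists (mscale (NngNum sV0) H').
  apply: (@admissible_plan_scaled mu0' mu1' mu0 mu1 H' _ k0^-1 k1^-1 s^-1) => //.
  - by rewrite invr_eq0 gt_eqF.
  - by rewrite invr_eq0 gt_eqF.
  - by move=> A mA; rewrite mu0E// inv.
  - by move=> A mA; rewrite mu1E// inv.
by move=> A mA; rewrite /= /mscale /= -{1}(invrK s) inv ?invr_gt0// invrK.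
Qed.

(** Zero is a density of both marginals and [entropy_fun 0 = 1], so each entropy is the mass of its
    reference measure. *)
Lemma LET_null (ell : R) mu0 mu1 H : admissible_plan mu0 mu1 H ->
  H setT = 0 -> LET ell H mu0 mu1 = mu0 setT + mu1 setT.
Proof.
move=> [H0 H1] HT0.
have HA0 A : measurable A -> H A = 0.
  move=> mA; apply/eqP; rewrite eq_le measure_ge0 andbT -HT0.
  by apply: le_measure; rewrite ?inE.
have E0 nu mu : nu `<< mu -> (forall A, measurable A -> nu A = 0) ->
    \int[mu]_x (entropy_fun (density nu mu x))%:E = mu setT.
  move=> numu nu0; rewrite (integral_entropy_density _ _ (cst 0%R))//.
    under eq_integral do rewrite /= /entropy_fun mul0r subr0 add0r.
    by rewrite integral_cst// mul1e.
  by move=> A mA; rewrite nu0// integral0.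
(* A null measure is any multiple of itself; factor [0] then gives null marginals. *)
have HA0' (s : R) B : measurable B -> H B = s%:E * H B.
  by move=> mB; rewrite HA0// mule0.
rewrite /LET !E0//; last 2 first.
- by move=> A mA; rewrite [LHS](marginal1_scaled (HA0' 0%R) mA) mul0e.
- by move=> A mA; rewrite [LHS](marginal0_scaled (HA0' 0%R) mA) mul0e.
rewrite (@eq_measure_integral _ _ _ _ mzero) ?integral_measure_zero ?adde0//.
by move=> A mA _; exact: HA0.
Qed.

(** Both marginals have total mass [H setT]. *)
Lemma admissible_plan_null {mu0 mu1 H} : admissible_plan mu0 mu1 H ->
  mu0 setT = 0 \/ mu1 setT = 0 -> H setT = 0.
Proof.
by move=> [/null_content_dominatesP H0 /null_content_dominatesP H1] [mu0T|mu1T];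
  [exact: (H0 setT)|exact: (H1 setT)].
Qed.

(** The infimum is over a single value: every admissible plan is null, and the zero measure is
    admissible. *)
Lemma HK2_null (ell : R) mu0 mu1 : mu0 setT = 0 \/ mu1 setT = 0 ->
  HK2 ell mu0 mu1 = mu0 setT + mu1 setT.
Proof.
move=> mu0T; rewrite /HK2.
suff -> : [set LET ell H mu0 mu1 | H in admissible_plan mu0 mu1] =
          [set mu0 setT + mu1 setT] by rewrite ereal_inf1.
apply/seteqP; split=> [_ [H adm <-]|_ ->] /=.
  by rewrite LET_null//; exact: admissible_plan_null adm mu0T.
exists mzero; last by rewrite LET_null//; split.
by split; apply/null_content_dominatesP.
Qed.

Lemma HK2_scaled (ell : R)
    (mu0 mu1 mu0' mu1' : {finite_measure set (borel X) -> \bar R}) (r0 r1 : R) :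
  (0 < r0)%R -> (0 < r1)%R ->
  (forall A, measurable A -> mu0' A = (r0 ^+ 2)%:E * mu0 A) ->
  (forall A, measurable A -> mu1' A = (r1 ^+ 2)%:E * mu1 A) ->
  HK2 ell mu0' mu1' = (r0 * r1)%:E * HK2 ell mu0 mu1 +
    (r0 ^+ 2 - r0 * r1)%:E * mu0 setT + (r1 ^+ 2 - r0 * r1)%:E * mu1 setT.
Proof.
move=> r00 r10 mu0E mu1E.
have s0 : (0 < r0 * r1)%R by exact: mulr_gt0.
have [k00 k10] : (0 < r0 ^+ 2)%R /\ (0 < r1 ^+ 2)%R by rewrite !exprn_gt0.
have fin0 : (r0 ^+ 2 - r0 * r1)%:E * mu0 setT \is a fin_num.
  by rewrite fin_numM// fin_num_measure.
have fin1 : (r1 ^+ 2 - r0 * r1)%:E * mu1 setT \is a fin_num.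
  by rewrite fin_numM// fin_num_measure.
apply/eqP; rewrite eq_le; apply/andP; split.
  (* The finite additive terms move to the left and the positive factor enters the infimum; each
     admissible [H] then yields the competitor [r0 * r1] times [H]. *)
  rewrite -leeBlDr// -leeBlDr// /HK2 -ereal_inf_pZl//.
  apply: le_ereal_inf_tmp => _ [_ [H adm <-] <-].
  rewrite leeBlDr// leeBlDr//; apply: ereal_inf_lbound => /=.
  have HE A : measurable A ->
    mscale (NngNum (ltW s0)) H A = (r0 * r1)%:E * H A by [].
  exists (mscale (NngNum (ltW s0)) H); last exact: LET_scaled r00 r10 mu0E mu1E HE adm.
  exact: admissible_plan_scaled (lt0r_neq0 k00) (lt0r_neq0 k10) mu0E mu1E HE adm.
(* Conversely, every competitor is [r0 * r1] times an admissible plan. *)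
apply: le_ereal_inf_tmp => _ [H' adm' <-].
have [H adm HE] := admissible_plan_unscaled k00 k10 s0 mu0E mu1E adm'.
rewrite (LET_scaled r00 r10 mu0E mu1E HE adm).
rewrite !leeD2r// lee_pmul2l//; by apply: ereal_inf_lbound; exists H.
Qed.

(** Every competitor is a rescaled admissible plan, and the affine change of the cost has positive
    slope, so it preserves the order. *)
Lemma optimal_plan_scaled {ell : R}
    {mu0 mu1 mu0' mu1' : {finite_measure set (borel X) -> \bar R}} {H H'}
    {r0 r1 : R} :
  (0 < r0)%R -> (0 < r1)%R ->
  (forall A, measurable A -> mu0' A = (r0 ^+ 2)%:E * mu0 A) ->
  (forall A, measurable A -> mu1' A = (r1 ^+ 2)%:E * mu1 A) ->
  (forall A, measurable A -> H' A = (r0 * r1)%:E * H A) ->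
  optimal_plan ell mu0 mu1 H -> optimal_plan ell mu0' mu1' H'.
Proof.
move=> r00 r10 mu0E mu1E HE [adm opt].
have s0 : (0 < r0 * r1)%R by exact: mulr_gt0.
have [k00 k10] : (0 < r0 ^+ 2)%R /\ (0 < r1 ^+ 2)%R by rewrite !exprn_gt0.
split.
  exact: admissible_plan_scaled (lt0r_neq0 k00) (lt0r_neq0 k10) mu0E mu1E HE adm.
move=> K' /(admissible_plan_unscaled k00 k10 s0 mu0E mu1E)[K admK KE].
rewrite (LET_scaled r00 r10 mu0E mu1E HE adm).
rewrite (LET_scaled r00 r10 mu0E mu1E KE admK).
by rewrite !leeD2r// lee_pmul2l//; exact: opt.
Qed.

End scaling.

Theorem theorem3p3 (R : realType) (X : completeMetricType R)
    (Xsep : separable_space X) (Xgeo : geodesic_space X)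
    (ell : R) (ell_gt0 : (0 < ell)%R) :
  forall (mu0 mu1 : {finite_measure set (borel X) -> \bar R})
         (r0 r1 : {nonneg R}),
    HK2 ell (mscale ((r0%:num ^+ 2)%:nng)%R mu0) (mscale ((r1%:num ^+ 2)%:nng)%R mu1) =
      (r0%:num * r1%:num)%:E * HK2 ell mu0 mu1 +
      (r0%:num ^+ 2 - r0%:num * r1%:num)%:E * mu0 [set: X] +
      (r1%:num ^+ 2 - r0%:num * r1%:num)%:E * mu1 [set: X]
    /\
    forall H : {finite_measure set (borel (X * X)%type) -> \bar R},
      optimal_plan ell mu0 mu1 H ->
      optimal_plan ell (mscale ((r0%:num ^+ 2)%:nng)%R mu0)
        (mscale ((r1%:num ^+ 2)%:nng)%R mu1)
        (mscale ((r0%:num * r1%:num)%:nng)%R H).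
Proof.
move=> mu0 mu1 r0 r1.
have [s0|] := eqVneq (r0%:num * r1%:num)%R 0%R; last first.
  rewrite mulf_eq0 negb_or => /andP[r0N0 r1N0].
  have r00 : (0 < r0%:num)%R by rewrite lt0r r0N0/=.
  have r10 : (0 < r1%:num)%R by rewrite lt0r r1N0/=.
  split=> [|H opt]; first exact: HK2_scaled.
  exact: (optimal_plan_scaled (H := H) r00 r10).
set mu0' := mscale _ mu0; set mu1' := mscale _ mu1.
have null : mu0' setT = 0 \/ mu1' setT = 0.
  move/eqP: s0; rewrite mulf_eq0 => /orP[] /eqP r_eq0; [left|right].
  - by transitivity ((r0%:num ^+ 2)%:E * mu0 setT); rewrite // r_eq0 expr0n mul0e.
  - by transitivity ((r1%:num ^+ 2)%:E * mu1 setT); rewrite // r_eq0 expr0n mul0e.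
split=> [|H [adm _]].
  (* [0 * HK2] is [0] whatever the value of [HK2]; the two rescaled masses remain. *)
  by rewrite s0 !subr0 mul0e add0e HK2_null.
have adm' : admissible_plan mu0' mu1' (mscale ((r0%:num * r1%:num)%:nng)%R H).
  have HE A : measurable A ->
      mscale ((r0%:num * r1%:num)%:nng)%R H A = (r0%:num * r1%:num)%:E * H A by [].
  split; apply/null_content_dominatesP => A mA _.
  - by rewrite [LHS](marginal0_scaled HE mA) s0 mul0e.
  - by rewrite [LHS](marginal1_scaled HE mA) s0 mul0e.
split=> // K admK.
(* All admissible plans are null here, so they have the same cost. *)
by rewrite !LET_null//; [exact: admissible_plan_null admK null|exact: admissible_plan_null adm' null].
Qed.
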